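(* Let $G,H$ be simple digraphs and let $f,g:G\to H$ be triangle-collapsing digraph maps. A vertex map $F:V(G)\times\{0,1\}\to V(H)$ is a one-step $\mathcal S_{\mathbf{TcOSC}}$-homotopy from $\mathrm{dFl}(f)$ to $\mathrm{dFl}(g)$ if and only if all of the following conditions hold: 1. for all $x,y\in V(G)$: if $x=y$ or $x\to y$ in $G$, then $f(x)=g(y)$ or $f(x)\to g(y)$ in $H$; 2. for all $x,y\in V(G)$: if $x\to y$ in $G$ and $f(x)=g(y)$, then $f(x)=f(y)=g(x)=g(y)$; 3. $F\circ\iota_0=f$ and $F\circ\iota_1=g$, where $\iota_j(v)=(v,j)$.
   Context: A digraph is a pair $G=(V,E)$ with $V$ an arbitrary set and $E\subseteq V\times V$; all digraphs are simple, i.e. have no self-loops (reciprocal edges $v\to w$, $w\to v$ are allowed). $v\to w$ means $(v,w)\in E$. A directed $k$-clique is a $k$-tuple $v_0\dots v_{k-1}$ of distinct vertices with $v_i\to v_j$ whenever $i<j$. A map $f:V(G)\to V(H)$ is a triangle-collapsing digraph map if $v\to w$ in $G$ implies $f(v)=f(w)$ or $f(v)\to f(w)$ in $H$, and whenever $v_0v_1v_2$ is a directed $3$-clique of $G$ with $f(v_0)=f(v_2)$ then $f(v_0)=f(v_1)=f(v_2)$. An ordered simplicial complex on a set $V=V(K)$ is a set $K$ of sequences $v_0\dots v_k$ of distinct elements of $V$ containing all singletons and closed under deleting any one vertex. A triangle-collapsing simplicial morphism $K_1\to K_2$ is a map $f:V(K_1)\to V(K_2)$ such that for each $p\in K_1$,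 the vertexwise image $f(p)$ either has a repeated vertex or is in $K_2$, and such that $v_0v_1v_2\in K_1$ with $f(v_0)=f(v_2)$ implies $f(v_0)=f(v_1)=f(v_2)$. The directed flag complex $\mathrm{dFl}(G)$ is the ordered simplicial complex on $V(G)$ of all directed cliques of $G$; a triangle-collapsing digraph map $f:G\to H$ induces a triangle-collapsing simplicial morphism $\mathrm{dFl}(f):\mathrm{dFl}(G)\to\mathrm{dFl}(H)$ with the same vertex map. For an ordered simplicial complex $K$, $\mathrm{Cyl}(K)$ is the set of paths on $V(K)\times\{0,1\}$ of the forms $(v_0,0)\dots(v_k,0)$, $(v_0,1)\dots(v_k,1)$, $(v_0,0)\dots(v_i,0)(v_i,1)\dots(v_k,1)$ ($0\le i\le k$) with $v_0\dots v_k\in K$, and $\overline{\mathrm{Cyl}(K)}$ is the smallest ordered simplicial complex containing it. A one-step $\mathcal S_{\mathbf{TcOSC}}$-homotopy from $a$ to $b$ (both $K_1\to K_2$) is a triangle-collapsing simplicial morphism $F:\overline{\mathrm{Cyl}(K_1)}\to K_2$ with $F\circ\iota_0=a$ and $F\circ\iota_1=b$. *)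

(* Defs.v *)
From Stdlib Require Import List Classical.
Import ListNotations.

Set Implicit Arguments.
Unset Strict Implicit.

Record digraph : Type := Digraph {
  vertex :> Type;
  edge : vertex -> vertex -> Prop;
  edge_irrefl : forall v, ~ edge v v
}.

(** The clause [ForallOrdPairs] says [v_i -> v_j] whenever [i < j]. *)
Definition directed_clique (G : digraph) (p : list G) : Prop :=
  NoDup p /\ ForallOrdPairs (@edge G) p.

Record tc_digraph_map (G H : digraph) : Type := TcDigraphMap {
  dmap :> G -> H;
  dmap_edge : forall v w, edge v w -> dmap v = dmap w \/ edge (dmap v) (dmap w);
  dmap_triangle : forall v0 v1 v2, directed_clique [v0; v1; v2] ->
    dmap v0 = dmap v2 -> dmap v0 = dmap v1 /\ dmap v1 = dmap v2
}.

(** Simplices are nonempty sequences [v_0 ... v_k], [k >= 0], so deleting the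
    only vertex of a singleton is excluded from the closure condition. *)
Record osc (V : Type) : Type := Osc {
  simplex :> list V -> Prop;
  simplex_nonempty : forall p, simplex p -> p <> [];
  simplex_nodup : forall p, simplex p -> NoDup p;
  simplex_singleton : forall v, simplex [v];
  simplex_face : forall l v r,
    simplex (l ++ v :: r) -> l ++ r <> [] -> simplex (l ++ r)
}.

Definition is_tc_morphism (V W : Type) (K : osc V) (L : osc W) (f : V -> W)
    : Prop :=
  (forall p, K p -> ~ NoDup (map f p) \/ L (map f p)) /\
  (forall v0 v1 v2, K [v0; v1; v2] -> f v0 = f v2 ->
     f v0 = f v1 /\ f v1 = f v2).

Record tc_morphism (V W : Type) (K : osc V) (L : osc W) : Type := TcMorphism {
  smap :> V -> W;
  smapP : is_tc_morphism K L smap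
}.

Lemma ForallOrdPairs_remove (A : Type) (R : A -> A -> Prop) l v r :
  ForallOrdPairs R (l ++ v :: r) -> ForallOrdPairs R (l ++ r).
Proof.
induction l as [|a l IH]; simpl; intros H; inversion H; subst; auto.
constructor; auto.
rewrite Forall_app in *; destruct H2 as [H2 H2'].
inversion H2'; auto.
Qed.

Definition dFl (G : digraph) : osc G.
Proof.
refine (@Osc G (fun p => p <> [] /\ directed_clique p) _ _ _ _).
- intros p [Hp _]; exact Hp.
- intros p [_ [Hp _]]; exact Hp.
- intros v; split; [discriminate | split].
  + constructor; [intros [] | constructor].
  + repeat constructor.
- intros l v r [_ [Hd Hc]] Hn; split; [exact Hn | split].
  + exact (NoDup_remove_1 _ _ _ Hd).
  + exact (ForallOrdPairs_remove Hc).
Defined.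

Lemma dFl_map_subproof (G H : digraph) (f : tc_digraph_map G H) :
  is_tc_morphism (dFl G) (dFl H) f.
Proof.
split.
- intros p [Hn [_ Hc]].
  destruct (classic (NoDup (map f p))) as [Hf|Hf]; [right | left; exact Hf].
  split; [|split; [exact Hf|]].
  + destruct p; [contradiction | discriminate].
  + clear Hn; induction Hc as [|a p Ha Hc IH]; simpl; constructor.
    * inversion Hf as [|x l Hx Hl]; subst.
      rewrite Forall_map, Forall_forall in *; intros b Hb.
      destruct (dmap_edge f (Ha b Hb)) as [E|E]; [|exact E].
      elim Hx; rewrite E; apply in_map; exact Hb.
    * apply IH; inversion Hf; assumption.
- intros v0 v1 v2 [_ Hc]; exact (@dmap_triangle _ _ f _ _ _ Hc).
Qed.

Definition dFl_map (G H : digraph) (f : tc_digraph_map G H)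
    : tc_morphism (dFl G) (dFl H) :=
  TcMorphism (dFl_map_subproof f).

(** [{0, 1}] is [bool], with [false] for [0] and [true] for [1]. *)
Definition iota (V : Type) (j : bool) (v : V) : V * bool := (v, j).

Inductive cyl (V : Type) (K : osc V) : list (V * bool) -> Prop :=
| cyl_level j p : K p -> cyl K (map (iota j) p)
| cyl_step l v r : K (l ++ v :: r) ->
    cyl K (map (iota false) (l ++ [v]) ++ map (iota true) (v :: r)).

(** The smallest ordered simplicial complex containing [P], as the intersection
    of all of them; the hypothesis on [P] makes this family nonempty. *)
Definition osc_closure (V : Type) (P : list V -> Prop)
    (HP : forall p, P p -> p <> [] /\ NoDup p) : osc V.
Proof.
assert (full : {L : osc V | (forall p, P p -> L p)}).
{ unshelve eexists (@Osc V (fun p => p <> [] /\ NoDup p) _ _ _ _).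
  - intros p [Hp _]; exact Hp.
  - intros p [_ Hp]; exact Hp.
  - intros v; split; [discriminate | constructor; [intros [] | constructor]].
  - intros l v r [_ Hd] Hn; split; [exact Hn | exact (NoDup_remove_1 _ _ _ Hd)].
  - exact HP. }
refine (@Osc V (fun p => forall L : osc V, (forall q, P q -> L q) -> L p)
          _ _ _ _).
- intros p Hp; destruct full as [L HL]; exact (simplex_nonempty (Hp L HL)).
- intros p Hp; destruct full as [L HL]; exact (simplex_nodup (Hp L HL)).
- intros v L _; exact (simplex_singleton L v).
- intros l v r Hp Hn L HL; exact (simplex_face (Hp L HL) Hn).
Defined.

Lemma NoDup_map_iota (V : Type) (j : bool) (p : list V) :
  NoDup p -> NoDup (map (iota j) p).
Proof.
apply NoDup_map_NoDup_ForallPairs.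
intros x y _ _ E; injection E; auto.
Qed.

Lemma cyl_nodup (V : Type) (K : osc V) p : cyl K p -> p <> [] /\ NoDup p.
Proof.
intros [j q Hq|l v r Hq].
- split.
  + destruct q; [elim (simplex_nonempty Hq); reflexivity | discriminate].
  + exact (NoDup_map_iota j (simplex_nodup Hq)).
- pose proof (simplex_nodup Hq) as Hd; split.
  + destruct l; discriminate.
  + apply NoDup_app.
    * apply NoDup_map_iota.
      apply (NoDup_app_remove_r (l ++ [v]) r).
      rewrite <- app_assoc; exact Hd.
    * apply NoDup_map_iota; exact (NoDup_app_remove_l l (v :: r) Hd).
    * intros x Hx Hy; apply in_map_iff in Hx, Hy.
      destruct Hx as [a [Ea _]], Hy as [b [Eb _]].
      rewrite <- Ea in Eb; discriminate.
Qed.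

Definition cyl_closure (V : Type) (K : osc V) : osc (V * bool) :=
  osc_closure (@cyl_nodup V K).

Definition one_step_homotopy (V W : Type) (K : osc V) (L : osc W)
    (a b : tc_morphism K L) (F : V * bool -> W) : Prop :=
  is_tc_morphism (cyl_closure K) L F /\
  (forall v, F (iota false v) = a v) /\
  (forall v, F (iota true v) = b v).

(* Main.v *)
Require Import Defs.
From Stdlib Require Import List Classical.
Import ListNotations.

Set Implicit Arguments.
Unset Strict Implicit.

(** Being a triangle-collapsing morphism into a directed flag complex is a
    condition on pairs and triples of vertices only, so everything depends on
    which pairs and triples are simplices of the closed cylinder.

    The pairs are the edges of the prism digraph over [G]: the edges of [G] on
    both levels, together with [(x, 0) -> (y, 1)] whenever [x = y] or [x -> y].
    Hence condition 1 says exactly that [F] weakly preserves the edges between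
    the levels, and flagness of [dFl H] extends this from edges to all simplices.

    The triples need more care.  If [x -> y] and [y -> x], then
    [(x, 0) (y, 0) (x, 1)] is a directed clique of the prism, but it is not in
    the closed cylinder, and it is not collapsed even for [f = g = id].  In a
    simplex of the cylinder the two copies of a vertex are adjacent, so the
    outer vertices of a triple always lie over distinct vertices of [G].
    [prism_complex] records this constraint ([cyl_closure_prism]).  For a mixed
    triple over [x], [y], [z], with [x] at level 0 and [z] at level 1, it forces
    [x -> z]; then condition 2 turns [f x = g z] into [f x = f z = g x = g z],
    and the triangle condition for [f] or for [g] takes care of [y].

    Conversely, conditions 1 and 2 are read off from the simplices
    [(x, 0) (x, 1)], [(x, 0) (x, 1) (y, 1)] and [(x, 0) (y, 0) (y, 1)]. *)

(** * Ordered triples of a list *)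

Inductive ForallOrdTriples (A : Type) (P : A -> A -> A -> Prop)
    : list A -> Prop :=
| FOT_nil : ForallOrdTriples P []
| FOT_cons a p : ForallOrdPairs (P a) p -> ForallOrdTriples P p ->
    ForallOrdTriples P (a :: p).

Lemma ForallOrdTriples_remove (A : Type) (P : A -> A -> A -> Prop) l v r :
  ForallOrdTriples P (l ++ v :: r) -> ForallOrdTriples P (l ++ r).
Proof.
induction l as [|a l IH]; simpl; intros H; inversion H; subst; auto.
constructor; auto.
eapply ForallOrdPairs_remove; eassumption.
Qed.

Lemma Forall_ForallOrdPairs_r (A : Type) (Q : A -> Prop) p :
  Forall Q p -> ForallOrdPairs (fun _ c => Q c) p.
Proof. induction 1; constructor; auto. Qed.

Lemma ForallOrdPairs_map (A B : Type) (f : A -> B) (R : A -> A -> Prop)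
    (S : B -> B -> Prop) p :
  (forall x y, R x y -> S (f x) (f y)) ->
  ForallOrdPairs R p -> ForallOrdPairs S (map f p).
Proof.
intros HRS; induction 1 as [|a p Ha Hp IH]; simpl; constructor; auto.
rewrite Forall_map; revert Ha; apply Forall_impl; auto.
Qed.

Lemma not_NoDup_pair (A : Type) (a b : A) : ~ NoDup [a; b] -> a = b.
Proof.
intros H; apply NNPP; intros Hab; apply H.
constructor; [intros [E|[]]; auto|].
constructor; [intros []|constructor].
Qed.

Lemma directed_clique_triangle (G : digraph) (x y z : G) :
  edge x y -> edge x z -> edge y z -> directed_clique [x; y; z].
Proof.
intros Hxy Hxz Hyz; split.
- repeat constructor; simpl; intros E; intuition subst;
    eapply edge_irrefl; eassumption.
- repeat constructor; assumption.
Qed.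

(** * The prism over a digraph *)

Definition prism_edge (G : digraph) (a b : G * bool) : Prop :=
  match snd a, snd b with
  | false, true => fst a = fst b \/ edge (fst a) (fst b)
  | true, false => False
  | _, _ => edge (fst a) (fst b)
  end.

Lemma prism_edge_irrefl (G : digraph) (a : G * bool) : ~ prism_edge a a.
Proof. destruct a as [x [|]]; apply edge_irrefl. Qed.

Definition prism (G : digraph) : digraph := Digraph (@prism_edge_irrefl G).

Definition ends_apart (V : Type) : V * bool -> V * bool -> V * bool -> Prop :=
  fun a _ c => fst a <> fst c.

(** The closed cylinder over [dFl G], described without reference to the
    generating paths: [ends_apart] excludes the cliques of the prism in which
    another vertex separates the two copies of a vertex. *)
Definition prism_complex (G : digraph) : osc (G * bool).
Proof.
refine (@Osc (G * bool)
  (fun p => dFl (prism G) p /\ ForallOrdTriples (@ends_apart G) p) _ _ _ _).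
- intros p [Hp _]; exact (simplex_nonempty Hp).
- intros p [Hp _]; exact (simplex_nodup Hp).
- intros v; split; [exact (simplex_singleton (dFl (prism G)) v)|].
  repeat constructor.
- intros l v r [Hp Ht] Hn; split.
  + exact (simplex_face Hp Hn).
  + exact (ForallOrdTriples_remove Ht).
Defined.

Lemma level_ends_apart (V : Type) (j : bool) (p : list V) :
  NoDup p -> ForallOrdTriples (@ends_apart V) (map (iota j) p).
Proof.
induction 1 as [|a p Ha Hp IH]; simpl; constructor; auto.
apply Forall_ForallOrdPairs_r with (Q := fun c => a <> fst c).
rewrite Forall_map, Forall_forall.
intros c Hc E; apply Ha; simpl in E; rewrite E; exact Hc.
Qed.

Lemma Forall_step (V : Type) (Q : V -> Prop) l v r : Forall Q (l ++ v :: r) ->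
  Forall (fun c => Q (fst c))
    (map (iota false) (l ++ [v]) ++ map (iota true) (v :: r)).
Proof.
rewrite !Forall_app, !Forall_map, Forall_app; intros [Hl Hr].
split; [split; [exact Hl|]|exact Hr].
inversion Hr; constructor; auto.
Qed.

(** The path repeats a vertex of [V] only at the step from [(v, 0)] to
    [(v, 1)].  These two are adjacent, so [(v, 1)] can be the middle of a triple
    starting at [(v, 0)] but never its end. *)
Lemma step_ends_apart (V : Type) (l : list V) v r : NoDup (l ++ v :: r) ->
  ForallOrdTriples (@ends_apart V)
    (map (iota false) (l ++ [v]) ++ map (iota true) (v :: r)).
Proof.
induction l as [|a l IH]; simpl; intros Hd; inversion Hd; subst.
- constructor; [|exact (level_ends_apart true Hd)].
  assert (Hv : Forall (fun c => v <> fst c) (map (iota true) r)).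
  { rewrite Forall_map, Forall_forall; intros c Hc E; simpl in E; subst; auto. }
  constructor; [exact Hv|].
  exact (Forall_ForallOrdPairs_r Hv).
- constructor; [|auto].
  apply Forall_ForallOrdPairs_r with (Q := fun c => a <> fst c).
  apply (@Forall_step _ (fun c => a <> c)), Forall_forall.
  intros c Hc E; subst; auto.
Qed.

Lemma step_prism_clique (G : digraph) (l : list G) v r :
  ForallOrdPairs (@edge G) (l ++ v :: r) ->
  ForallOrdPairs (@prism_edge G)
    (map (iota false) (l ++ [v]) ++ map (iota true) (v :: r)).
Proof.
induction l as [|a l IH]; simpl; intros Hc; inversion Hc; subst.
- constructor.
  + constructor; [left; reflexivity|].
    rewrite Forall_map; revert H1; apply Forall_impl.
    intros b Hb; right; exact Hb.
  + apply (@ForallOrdPairs_map _ _ (iota true) (@edge G) _ (v :: r)); auto.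
- constructor; [|exact (IH H2)].
  generalize (Forall_step H1); apply Forall_impl.
  intros [c [|]] E; [right|]; exact E.
Qed.

Lemma cyl_prism (G : digraph) p : cyl (dFl G) p -> prism_complex G p.
Proof.
intros Hp; destruct (cyl_nodup Hp) as [Hn Hd].
destruct Hp as [j p [_ [Hpd Hpc]]|l v r [_ [Hpd Hpc]]].
- split; [split; [exact Hn|split; [exact Hd|]]|exact (level_ends_apart j Hpd)].
  revert Hpc; apply ForallOrdPairs_map; destruct j; auto.
- split; [split; [exact Hn|split; [exact Hd|]]|exact (step_ends_apart Hpd)].
  exact (step_prism_clique Hpc).
Qed.

Lemma cyl_closure_prism (G : digraph) p :
  cyl_closure (dFl G) p -> prism_complex G p.
Proof. intros Hp; exact (Hp _ (@cyl_prism G)). Qed.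

(** * Simplices of the closed cylinder *)

Lemma cyl_in_closure (V : Type) (K : osc V) p : cyl K p -> cyl_closure K p.
Proof. intros Hp L HL; exact (HL p Hp). Qed.

Lemma dFl_edge (G : digraph) (x y : G) : edge x y -> dFl G [x; y].
Proof.
intros Hxy; split; [discriminate|split].
- repeat constructor; simpl; intros E; intuition subst;
    eapply edge_irrefl; eassumption.
- repeat constructor; assumption.
Qed.

Lemma closure_vertical (V : Type) (K : osc V) x :
  cyl_closure K [(x, false); (x, true)].
Proof.
exact (cyl_in_closure (@cyl_step _ K [] x [] (simplex_singleton K x))).
Qed.

Lemma closure_upper_triangle (V : Type) (K : osc V) x y :
  K [x; y] -> cyl_closure K [(x, false); (x, true); (y, true)].
Proof. intros Hxy; exact (cyl_in_closure (@cyl_step _ K [] x [y] Hxy)). Qed.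

Lemma closure_lower_triangle (V : Type) (K : osc V) x y :
  K [x; y] -> cyl_closure K [(x, false); (y, false); (y, true)].
Proof. intros Hxy; exact (cyl_in_closure (@cyl_step _ K [x] y [] Hxy)). Qed.

Lemma closure_diagonal (V : Type) (K : osc V) x y :
  K [x; y] -> cyl_closure K [(x, false); (y, true)].
Proof.
intros Hxy.
apply (@simplex_face _ _ [(x, false)] (x, true) [(y, true)]);
  [exact (closure_upper_triangle Hxy)|discriminate].
Qed.

(** * Maps into a directed flag complex *)

Lemma weak_edge_map_clique (G H : digraph) (F : G -> H) :
  (forall a b, edge a b -> F a = F b \/ edge (F a) (F b)) ->
  forall p, dFl G p -> ~ NoDup (map F p) \/ dFl H (map F p).
Proof.
intros HF p [Hn [_ Hc]].
destruct (classic (NoDup (map F p))) as [Hd|Hd]; [right|left; exact Hd].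
split; [destruct p; [contradiction|discriminate]|split; [exact Hd|]].
clear Hn; induction Hc as [|a p Ha Hc IH]; simpl in *; constructor.
- apply NoDup_cons_iff in Hd; destruct Hd as [Hx _].
  rewrite Forall_map, Forall_forall in *; intros b Hb.
  destruct (HF _ _ (Ha b Hb)) as [E|E]; [|exact E].
  elim Hx; rewrite E; apply in_map; exact Hb.
- apply IH; apply NoDup_cons_iff in Hd; tauto.
Qed.

Lemma morphism_pair (V : Type) (H : digraph) (K : osc V) (F : V -> H) a b :
  is_tc_morphism K (dFl H) F -> K [a; b] -> F a = F b \/ edge (F a) (F b).
Proof.
intros [HF _] Hab; destruct (HF _ Hab) as [Hd|[_ [_ Hc]]].
- left; exact (not_NoDup_pair Hd).
- right; inversion Hc as [|? ? Ha _]; inversion Ha; assumption.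
Qed.

Section PrismMap.

Variables (G H : digraph) (f g : tc_digraph_map G H) (F : G * bool -> H).
Hypothesis weak_fg :
  forall x y : G, x = y \/ edge x y -> f x = g y \/ edge (f x) (g y).
Hypothesis collapse_fg : forall x y : G, edge x y -> f x = g y ->
  f x = f y /\ f y = g x /\ g x = g y.
Hypothesis F0 : forall v : G, F (v, false) = f v.
Hypothesis F1 : forall v : G, F (v, true) = g v.

Lemma prism_map_edge (a b : prism G) :
  edge a b -> F a = F b \/ edge (F a) (F b).
Proof.
destruct a as [x [|]], b as [y [|]]; simpl; unfold prism_edge; simpl;
  rewrite ?F0, ?F1; intros E; [| contradiction | |]; auto using dmap_edge.
Qed.

(** The outer vertices of a mixed triple lie over an edge [x -> z], so
    [collapse_fg] moves the equality of their images to a single level, the one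
    that contains two vertices of the triple, where it is a statement about [f]
    alone or [g] alone. *)
Lemma prism_map_triangle (a b c : G * bool) :
  prism_complex G [a; b; c] -> F a = F c -> F a = F b /\ F b = F c.
Proof.
intros [[_ [_ Hc]] Ht].
inversion Hc as [|? ? Ha Hc']; inversion Hc' as [|? ? Hb _]; subst.
inversion Ha as [|? ? Hab Ha']; inversion Ha' as [|? ? Hac _]; subst.
inversion Hb as [|? ? Hbc _]; subst.
inversion Ht as [|? ? Hta _]; inversion Hta as [|? ? Htb _];
  inversion Htb as [|? ? Hne _]; subst.
clear Hc Ht Hc' Ha Ha' Hb Hta Htb.
destruct a as [x i], b as [y j], c as [z k].
unfold ends_apart in Hne; unfold edge, prism, prism_edge in Hab, Hac, Hbc.
destruct i, j, k; simpl in *; try contradiction; rewrite ?F0, ?F1; intros E.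
- apply (@dmap_triangle _ _ g); auto using directed_clique_triangle.
- destruct Hac as [|Hac]; [contradiction|].
  destruct (collapse_fg Hac E) as [Ez [Ex Eg]].
  destruct Hab as [->|Hab]; [split; congruence|].
  destruct (dmap_triangle (directed_clique_triangle Hab Hac Hbc) Eg).
  split; congruence.
- destruct Hac as [|Hac]; [contradiction|].
  destruct (collapse_fg Hac E) as [Ez [Ex Eg]].
  destruct Hbc as [->|Hbc]; [split; congruence|].
  destruct (dmap_triangle (directed_clique_triangle Hab Hac Hbc) Ez).
  split; congruence.
- apply (@dmap_triangle _ _ f); auto using directed_clique_triangle.
Qed.

Lemma prism_map_morphism : is_tc_morphism (cyl_closure (dFl G)) (dFl H) F.
Proof.
split.
- intros p Hp; destruct (cyl_closure_prism Hp) as [Hc _].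
  exact (weak_edge_map_clique prism_map_edge Hc).
- intros a b c Hp; exact (prism_map_triangle (cyl_closure_prism Hp)).
Qed.

End PrismMap.

Theorem corollary5p12 (G H : digraph) (f g : tc_digraph_map G H)
    (F : G * bool -> H) :
  one_step_homotopy (dFl_map f) (dFl_map g) F <->
  (forall x y : G, x = y \/ edge x y -> f x = g y \/ edge (f x) (g y)) /\
  (forall x y : G, edge x y -> f x = g y ->
     f x = f y /\ f y = g x /\ g x = g y) /\
  ((forall v : G, F (iota false v) = f v) /\
   (forall v : G, F (iota true v) = g v)).
Proof.
unfold one_step_homotopy, iota; simpl; split.
- intros [HF [F0 F1]]; split; [|split; [|split; assumption]].
  + intros x y Hxy; rewrite <- F0, <- F1; apply (morphism_pair HF).
    destruct Hxy as [<-|Hxy];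
      [apply closure_vertical|exact (closure_diagonal (dFl_edge Hxy))].
  + intros x y Hxy E; destruct HF as [_ HF].
    pose proof (HF _ _ _ (closure_upper_triangle (dFl_edge Hxy))) as Hu.
    pose proof (HF _ _ _ (closure_lower_triangle (dFl_edge Hxy))) as Hl.
    rewrite !F0, !F1 in Hu, Hl.
    destruct (Hu E), (Hl E); repeat split; congruence.
- intros [Hweak [Hcol [F0 F1]]]; split; [|split; assumption].
  exact (prism_map_morphism Hweak Hcol F0 F1).
Qed.
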